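(* Let $n=2$ and let $\hat\alpha=\bar X^2/S^2$ be the moment estimator of the shape parameter $\alpha$ based on a random sample $X_1,X_2$ from the gamma distribution with shape $\alpha>0$ and scale $\lambda>0$. Then $\hat\alpha$ is dispersively increasing in $\alpha$; that is, if $0<\alpha_1<\alpha_2$ and $\hat\alpha_i$ denotes the estimator based on a sample of size $2$ from the gamma distribution with shape $\alpha_i$ ($i=1,2$), then $\hat\alpha_1\leq_{\mathrm{disp}}\hat\alpha_2$.
   Context: The gamma distribution with shape $\alpha>0$ and scale $\lambda>0$ has density $f(x;\alpha,\lambda)=\frac{1}{\Gamma(\alpha)\lambda^{\alpha}}x^{\alpha-1}e^{-x/\lambda}$, $x>0$. A random sample is a collection of independent identically distributed random variables. For a sample $X_1,\dots,X_n$, $\bar X=\frac1n\sum_{i=1}^n X_i$ is the sample mean and $S^2=\frac1n\sum_{i=1}^n (X_i-\bar X)^2$ is the biased sample variance. For random variables $X,Y$ with distribution functions $F,G$ and quantile functions $F^{-1},G^{-1}$, $X\leq_{\mathrm{disp}}Y$ means that $F^{-1}(v)-F^{-1}(u)\le G^{-1}(v)-G^{-1}(u)$ for all $0<u<v<1$. *)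

(* Defs.v *)
From HB Require Import structures.
From mathcomp Require Import all_boot all_order all_algebra.
From mathcomp Require Import all_classical all_reals all_analysis.
From mathcomp Require Import measurable_realfun.

Set Implicit Arguments.
Unset Strict Implicit.
Unset Printing Implicit Defensive.

Import Order.TTheory GRing.Theory Num.Theory.
Import numFieldNormedType.Exports.

Local Open Scope classical_set_scope.
Local Open Scope ring_scope.

Section gamma_distribution.
Context {R : realType}.
Implicit Types a l x : R.

Definition gamma_fun a : R :=
  \int[lebesgue_measure]_(x in `]0, +oo[) (x `^ (a - 1) * expR (- x)).

(* [a] is the shape and [l] the scale (not the rate). *)
Definition gamma_pdf a l : R -> R :=
  (fun x => (gamma_fun a * l `^ a)^-1 * x `^ (a - 1) * expR (- (x / l)))
    \_ `]0, +oo[.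

End gamma_distribution.

Section random_samples.
Context d (T : measurableType d) (R : realType) (P : probability T R).

Definition mutually_independent n (X : 'I_n -> {RV P >-> R}) : Prop :=
  forall (J : {set 'I_n}) (A : 'I_n -> set R),
    (forall i, i \in J -> measurable (A i)) ->
    P (\bigcap_(i in [set i | i \in J]) (X i @^-1` A i)) =
    (\prod_(i in J) P (X i @^-1` A i))%E.

Definition has_pdf (X : {RV P >-> R}) (f : R -> R) : Prop :=
  forall A : set R, measurable A ->
    distribution P X A = (\int[lebesgue_measure]_(x in A) (f x)%:E)%E.

Definition random_sample n (f : R -> R) (X : 'I_n -> {RV P >-> R}) : Prop :=
  mutually_independent X /\ forall i, has_pdf (X i) f.

End random_samples.

Section statistics.
Context d (T : measurableType d) (R : realType) (P : probability T R).
Variables (n : nat) (X : 'I_n -> {RV P >-> R}).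

Definition sample_mean : T -> R :=
  fun w => n%:R^-1 * \sum_(i < n) X i w.

(* The biased version, with normalization [1/n]. *)
Definition sample_variance : T -> R :=
  fun w => n%:R^-1 * \sum_(i < n) (X i w - sample_mean w) ^+ 2.

(* Where the sample variance vanishes this takes the value 0, by the
   convention [x / 0 = 0]. *)
Definition moment_estimator_fun : T -> R :=
  fun w => sample_mean w ^+ 2 / sample_variance w.

Lemma measurable_sample_mean : measurable_fun setT sample_mean.
Proof.
apply: measurable_funM => //.
by apply: measurable_sum => i; exact: measurable_funP.
Qed.

Lemma measurable_sample_variance : measurable_fun setT sample_variance.
Proof.
apply: measurable_funM => //; apply: measurable_sum => i.
apply: measurable_funX; apply: measurable_funB => //.
exact: measurable_sample_mean.
Qed.

Lemma sample_variance_ge0 w : 0 <= sample_variance w.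
Proof. by rewrite mulr_ge0 ?invr_ge0// sumr_ge0// => i _; rewrite sqr_ge0. Qed.

Lemma measurable_moment_estimator_fun : measurable_fun setT moment_estimator_fun.
Proof.
rewrite (_ : moment_estimator_fun =
    fun w => sample_mean w ^+ 2 * sample_variance w `^ (-1)); last first.
  by apply/funext => w; rewrite powR_inv1// sample_variance_ge0.
apply: measurable_funM.
  by apply: measurable_funX; exact: measurable_sample_mean.
apply: (measurableT_comp (measurable_powR _)).
exact: measurable_sample_variance.
Qed.

HB.instance Definition _ := isMeasurableFun.Build _ _ _ _
  moment_estimator_fun measurable_moment_estimator_fun.

Definition moment_estimator : {RV P >-> R} := moment_estimator_fun.

End statistics.

(* The left-continuous generalized inverse of the distribution function; the set
   is nonempty and bounded below when [0 < u < 1]. *)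
Definition quantile d (T : measurableType d) (R : realType)
    (P : probability T R) (X : {RV P >-> R}) (u : R) : R :=
  inf [set x | (u%:E <= cdf X x)%E].

Definition disp_le d1 (T1 : measurableType d1) d2 (T2 : measurableType d2)
    (R : realType) (P1 : probability T1 R) (P2 : probability T2 R)
    (X : {RV P1 >-> R}) (Y : {RV P2 >-> R}) : Prop :=
  forall u v : R, 0 < u -> u < v -> v < 1 ->
    quantile X v - quantile X u <= quantile Y v - quantile Y u.

(* Main.v *)
(** With two observations the estimator is [((X1 + X2) / (X1 - X2)) ^ 2], a
function of the ratio [X1 / X2] alone. The ratio has density proportional to
[s ^ (a - 1) (1 + s) ^ (- 2 a)], so the estimator has density
[f_a(x) = K (x - 1) ^ (a - 1) x ^ (- a - 1/2)] on [x > 1].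

For [c >= 0] the derivative of [ln (f_a1(x - c) / f_a2(x))] is a rational
function whose sign pattern on [x > c + 1] is at most [+, -], hence this
likelihood ratio is quasi-concave. By the mean value theorem
[D(x) = F_a1(x - c) - F_a2(x)], which is nonpositive at [c + 1] and tends to [0]
at infinity, cannot become negative after a zero: two quantile intervals
violating the dispersive order would produce such a change of sign, with [c] the
difference of their left endpoints. That [c >= 0] is the usual stochastic order, which
follows from the ratio being decreasing for [c = 0]. The normalizing constants are
never computed. *)
Require Import Defs.
From mathcomp Require Import all_boot all_order all_algebra.
From mathcomp Require Import all_classical all_reals all_analysis.
From mathcomp Require Import measurable_realfun.
From mathcomp Require Import ring lra.

Import Order.TTheory GRing.Theory Num.Theory.
Import numFieldNormedType.Exports.

Local Open Scope classical_set_scope.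
Local Open Scope ring_scope.

(** * Crossings of shifted distribution functions *)

(** The logarithm of [K (x - 1) ^ (a - 1) x ^ (- a - 1/2)], with [k = ln K]. In this form the
    comparison of two densities becomes the sign of a difference with rational derivative. *)
Definition log_density {R : realType} (a k x : R) : R :=
  k + (a - 1) * ln (x - 1) - (a + 2^-1) * ln x.

Lemma is_derive_shift {R : realType} (f : R -> R) (c x df : R) :
  is_derive (x - c) 1 f df -> is_derive x 1 (fun y => f (y - c)) df.
Proof.
move=> fdf; rewrite -[df]mulr1.
apply: (@is_derive1_comp _ f (fun y => y - c)).
rewrite -[X in is_derive _ _ _ X]subr0.
exact: is_deriveB (is_derive_id x 1) (is_derive_cst c x 1).
Qed.

Lemma is_derive_log_density {R : realType} (a k x : R) : 1 < x ->
  is_derive x 1 (log_density a k) ((a - 1) / (x - 1) - (a + 2^-1) / x).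
Proof.
move=> x1.
have d1 : is_derive x 1 (fun y : R => ln (y - 1)) (x - 1)^-1.
  by apply: is_derive_shift; apply: is_derive1_ln; rewrite subr_gt0.
have d2 : is_derive x 1 (@ln R) x^-1 by apply: is_derive1_ln; lra.
have := is_deriveB (is_deriveD (is_derive_cst k x 1) (is_deriveZ (a - 1) d1))
  (is_deriveZ (a + 2^-1) d2).
by rewrite add0r.
Qed.

(** At the left endpoint only a one-sided limit is asked for: the density is unbounded near [1] when
    the shape is below [1], so the distribution function need not be differentiable there. *)
Lemma is_derive_MVT_right {R : realType} (f df : R -> R) (a b : R) : a < b ->
  f y @[y --> a^'+] --> f a ->
  (forall x, a < x <= b -> is_derive x 1 f (df x)) ->
  exists2 c, a < c < b & f b - f a = df c * (b - a).
Proof.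
move=> ab fa fdf.
have [x||c] := @MVT _ f df a b ab.
- by rewrite in_itv/= => /andP[? ?]; apply: fdf; lra.
- apply: derivable_oo_LRcontinuous_within; split => //.
    move=> x; rewrite in_itv/= => /andP[? ?].
    by have [] : is_derive x 1 f (df x) by apply: fdf; lra.
  apply: cvg_at_left_filter; apply: differentiable_continuous.
  apply/derivable1_diffP.
  by have [] : is_derive b 1 f (df b) by apply: fdf; lra.
- by rewrite in_itv/= => ? ?; exists c.
Qed.

Lemma is_derive_MVT {R : realType} (f df : R -> R) (a b : R) : a < b ->
  (forall x, a <= x <= b -> is_derive x 1 f (df x)) ->
  exists2 c, a < c < b & f b - f a = df c * (b - a).
Proof.
move=> ab fdf; apply: is_derive_MVT_right => //.
  apply: cvg_at_right_filter; apply: differentiable_continuous.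
  apply/derivable1_diffP.
  by have [] : is_derive a 1 f (df a) by apply: fdf; lra.
by move=> x ?; apply: fdf; lra.
Qed.

(** * Shape of the shifted log-likelihood ratio *)

Definition log_ratio {R : realType} (a1 k1 a2 k2 c x : R) : R :=
  log_density a1 k1 (x - c) - log_density a2 k2 x.

Definition dlog_ratio {R : realType} (a1 a2 c x : R) : R :=
  ((a1 - 1) / (x - c - 1) - (a1 + 2^-1) / (x - c)) -
  ((a2 - 1) / (x - 1) - (a2 + 2^-1) / x).

Lemma is_derive_log_ratio {R : realType} (a1 k1 a2 k2 c x : R) :
  0 <= c -> c + 1 < x ->
  is_derive x 1 (log_ratio a1 k1 a2 k2 c) (dlog_ratio a1 a2 c x).
Proof.
move=> c0 cx; apply: is_deriveB; last by apply: is_derive_log_density; lra.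
by apply: is_derive_shift; apply: is_derive_log_density; lra.
Qed.

(** Removing the shift [c] from both denominators can only increase the expression ([h1], [h2]);
    what is left is [(a1 - a2) (1 / (x - 1) - 1 / x)], which is negative. *)
Lemma dlog_ratio_lt0 {R : realType} (a1 a2 c x : R) :
  0 < a1 -> a1 < a2 -> a1 <= 1 \/ c = 0 -> 0 <= c -> c + 1 < x ->
  dlog_ratio a1 a2 c x < 0.
Proof.
move=> a10 a12 ac c0 cx; rewrite /dlog_ratio.
have u0 : 0 < x - c - 1 by lra.
have u1 : 0 < x - c by lra.
have v0 : 0 < x - 1 by lra.
have v1 : 0 < x by lra.
have h1 : (a1 + 2^-1) / x <= (a1 + 2^-1) / (x - c).
  by rewrite ler_wpM2l//; [lra|rewrite lef_pV2 ?posrE//; lra].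
have h2 : (a1 - 1) / (x - c - 1) <= (a1 - 1) / (x - 1).
  case: ac => [a11|->]; last by rewrite subr0.
  by rewrite ler_wnM2l//; [lra|rewrite lef_pV2 ?posrE//; lra].
have h3 : (a1 - a2) * (x - 1)^-1 < (a1 - a2) * x^-1.
  by rewrite ltr_nM2l ?ltf_pV2 ?posrE//; lra.
lra.
Qed.

(* With [u = x - c - 1], clearing denominators in [dlog_ratio] leaves a quadratic
   [A u ^+ 2 + B u + K] with [A <= 0 <= K], so its quotient by [u] decreases. *)
Lemma dlog_ratio_lt0_trans {R : realType} (a1 a2 c x y : R) :
  1 <= a1 -> a1 < a2 -> 0 <= c -> c + 1 < x -> x < y ->
  dlog_ratio a1 a2 c x < 0 -> dlog_ratio a1 a2 c y < 0.
Proof.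
move=> a11 a12 c0 cx xy.
pose A := - (3 / 2 * c) - (a2 - a1).
pose K := (a1 - 1) * (c * (c + 1)).
(* The cubic terms cancel, since [(a1 - 1) - (a1 + 1/2) - (a2 - 1) + (a2 + 1/2) = 0]; [A] is the
   coefficient of [u ^+ 2] and [K] is [N 0]. *)
pose N u := (a1 - 1) * (u + 1) * (u + c) * (u + c + 1)
  - (a1 + 2^-1) * u * (u + c) * (u + c + 1)
  - (a2 - 1) * u * (u + 1) * (u + c + 1)
  + (a2 + 2^-1) * u * (u + 1) * (u + c).
have dN z : c + 1 < z -> dlog_ratio a1 a2 c z =
    N (z - c - 1) / ((z - c - 1) * (z - c) * (z - 1) * z).
  move=> cz; rewrite /dlog_ratio /N; field.
  by apply/and4P; split; lra.
have dpos z : c + 1 < z -> 0 < ((z - c - 1) * (z - c) * (z - 1) * z)^-1.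
  by move=> cz; rewrite invr_gt0 !mulr_gt0//; lra.
rewrite !dN//; last by lra.
rewrite !pmulr_llt0 ?dpos//; last by lra.
set u := x - c - 1; set v := y - c - 1.
have u0 : 0 < u by rewrite /u; lra.
have uv : u < v by rewrite /u /v; lra.
(* The difference [N v / v - N u / u], multiplied by [u * v]; the linear coefficient drops out. *)
have NE : u * N v = v * N u + (v - u) * (A * u * v - K).
  by rewrite /N /A /K; field.
move=> Nu; rewrite -(pmulr_rlt0 _ u0) NE.
have K0 : 0 <= K by rewrite !mulr_ge0//; lra.
have A0 : A <= 0 by rewrite /A; lra.
have : A * u * v <= 0 by rewrite -mulrA mulr_le0_ge0// mulr_ge0//; lra.
move=> Auv.
have : v * N u < 0 by rewrite pmulr_rlt0//; lra.
have : (v - u) * (A * u * v - K) <= 0 by rewrite mulr_ge0_le0//; lra.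
lra.
Qed.

(** The drop from [x0] to [x1] yields a point of negative derivative, and negativity persists to the
    right: for [a1 <= 1] the derivative is negative everywhere, otherwise [dlog_ratio_lt0_trans]
    applies. *)
Lemma log_ratio_quasiconcave {R : realType} (a1 k1 a2 k2 c x0 x1 x2 : R) :
  0 < a1 -> a1 < a2 -> 0 <= c -> c + 1 < x0 -> x0 < x1 -> x1 < x2 ->
  log_ratio a1 k1 a2 k2 c x1 < log_ratio a1 k1 a2 k2 c x0 ->
  log_ratio a1 k1 a2 k2 c x2 <= log_ratio a1 k1 a2 k2 c x1.
Proof.
move=> a10 a12 c0 cx0 x01 x12 h10.
have [y /andP[y0 y1]] := @is_derive_MVT _ _ (dlog_ratio a1 a2 c) _ _ x01
  (fun x hx => is_derive_log_ratio a1 k1 a2 k2 c x c0 ltac:(lra)).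
have [z /andP[z0 z1]] := @is_derive_MVT _ _ (dlog_ratio a1 a2 c) _ _ x12
  (fun x hx => is_derive_log_ratio a1 k1 a2 k2 c x c0 ltac:(lra)).
move=> ez ey.
have dy : dlog_ratio a1 a2 c y < 0.
  by rewrite -(@pmulr_llt0 _ (x1 - x0))//; lra.
have dz : dlog_ratio a1 a2 c z < 0.
  have [a11|/ltW a11] := leP a1 1.
    by apply: dlog_ratio_lt0 => //; [left|lra].
  by apply: dlog_ratio_lt0_trans dy => //; lra.
have : dlog_ratio a1 a2 c z * (x2 - x1) < 0 by rewrite pmulr_llt0//; lra.
lra.
Qed.

Lemma log_ratio_decreasing {R : realType} (a1 k1 a2 k2 x0 x1 : R) :
  0 < a1 -> a1 < a2 -> 1 < x0 -> x0 < x1 ->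
  log_ratio a1 k1 a2 k2 0 x1 < log_ratio a1 k1 a2 k2 0 x0.
Proof.
move=> a10 a12 h0 x01.
have [y /andP[y0 y1]] := @is_derive_MVT _ _ (dlog_ratio a1 a2 0) _ _ x01
  (fun x hx => is_derive_log_ratio a1 k1 a2 k2 0 x (lexx 0) ltac:(lra)).
have dy : dlog_ratio a1 a2 0 y < 0.
  by apply: dlog_ratio_lt0 => //; [right|lra].
have : dlog_ratio a1 a2 0 y * (x1 - x0) < 0 by rewrite pmulr_llt0//; lra.
lra.
Qed.
(* The distribution function of [1 + Z], for [Z] beta prime of parameters
   [(a, 1/2)]; [k] is the logarithm of the normalizing constant. *)
Definition beta_prime_cdf {R : realType} (a k : R) (F : R -> R) : Prop :=
  [/\ F 1 = 0, F y @[y --> 1^'+] --> (0 : R), F y @[y --> +oo] --> (1 : R) &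
    forall x : R, 1 < x -> is_derive x 1 F (expR (log_density a k x))].

Lemma cvg_subr_pinfty {R : realType} (c : R) : x - c @[x --> +oo] --> +oo.
Proof.
apply/cvgryPge => A; near=> x; rewrite lerBrDr.
by near: x; apply: nbhs_pinfty_ge; exact: num_real.
Unshelve. all: by end_near. Qed.

Lemma beta_prime_cdf_lt {R : realType} {a k : R} {F : R -> R} (x y : R) :
  beta_prime_cdf a k F -> 1 <= x -> x < y -> F x < F y.
Proof.
move=> [F1 Fr _ dF] x1 xy; rewrite -subr_gt0.
have [|z hz|z ? ->] := @is_derive_MVT_right _ F (fun z => expR (log_density a k z)) _ _ xy.
- have [->|x1'] := eqVneq x 1; first by rewrite F1.
  apply: cvg_at_right_filter; apply: differentiable_continuous.
  apply/derivable1_diffP.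
  by have [] := dF x ltac:(rewrite lt_neqAle eq_sym x1' x1).
- by apply: dF; lra.
- by rewrite mulr_gt0 ?expR_gt0 ?subr_gt0.
Qed.

(** * From the likelihood ratio to the dispersive order *)

Section dispersion.
Context {R : realType} (a1 a2 k1 k2 : R) (F1 F2 : R -> R).
Hypotheses (a1_gt0 : 0 < a1) (a12 : a1 < a2).
Hypotheses (F1P : beta_prime_cdf a1 k1 F1) (F2P : beta_prime_cdf a2 k2 F2).

Let D (c x : R) : R := F1 (x - c) - F2 x.
Let dD (c x : R) : R := expR (log_density a1 k1 (x - c)) - expR (log_density a2 k2 x).

Let is_derive_D (c x : R) : 0 <= c -> c + 1 < x -> is_derive x 1 (D c) (dD c x).
Proof.
move=> c0 cx; have [_ _ _ d1] := F1P; have [_ _ _ d2] := F2P.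
by apply: is_deriveB; [apply: is_derive_shift; apply: d1|apply: d2]; lra.
Qed.

Let dD_lt0 (c x : R) : (dD c x < 0) = (log_ratio a1 k1 a2 k2 c x < 0).
Proof. by rewrite /dD /log_ratio !subr_lt0 ltr_expR. Qed.

Let dD_gt0 (c x : R) : (0 < dD c x) = (0 < log_ratio a1 k1 a2 k2 c x).
Proof. by rewrite /dD /log_ratio !subr_gt0 ltr_expR. Qed.

(** The point [c + 1] is always the left end of the support for the shifted [F1]. For [F2] it is so
    only when [c = 0]; otherwise [F2] is differentiable there. *)
Let cvg_D_right (c : R) : 0 <= c -> D c x @[x --> (c + 1)^'+] --> D c (c + 1).
Proof.
move=> c0; have [F11 r1 _ _] := F1P; have [F21 r2 _ d2] := F2P.
apply: cvgB.
  have E : c + 1 - c = 1 by ring.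
  apply: (@increasing_cvg_at_right_comp _ (fun x => x - c) F1 _ +oo%O).
  - by [].
  - by move=> x y _ _ ?; rewrite ltrD2r.
  - apply: cvg_at_right_filter.
    by apply: cvgB; [exact: cvg_id|exact: cvg_cst].
  - by rewrite E F11.
have [->|c0'] := eqVneq c 0; first by rewrite add0r F21.
apply: cvg_at_right_filter; apply: differentiable_continuous.
apply/derivable1_diffP; have [] // := d2 (c + 1).
by rewrite ltrDr lt_neqAle eq_sym c0'.
Qed.

(** As [D c] tends to [0] at infinity, a negative value must be followed by a rise, and the mean
    value theorem turns the rise into a point of positive derivative. *)
Let D_lt0_rises (c y : R) : 0 <= c -> c + 1 < y -> D c y < 0 ->
  exists2 z, y < z & 0 < log_ratio a1 k1 a2 k2 c z.
Proof.
move=> c0 cy Dy; have [_ _ l1 _] := F1P; have [_ _ l2 _] := F2P.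
have Dinfty : D c x @[x --> +oo] --> (0 : R).
  rewrite -(subrr 1). apply: cvgB; last exact: l2.
  exact: (cvg_comp _ _ (cvg_subr_pinfty c) l1).
have [z [yz Dz]] : exists z, y < z /\ D c y < D c z.
  near (pinfty_nbhs R) => z; exists z; split; near: z.
    by apply: nbhs_pinfty_gt; exact: num_real.
  exact: (cvgr_gt _ Dinfty).
have [x xyz e] := @is_derive_MVT _ (D c) (dD c) _ _ yz
  (fun x hx => is_derive_D c x c0 ltac:(lra)).
exists x; first lra.
by rewrite -dD_gt0 -(@pmulr_lgt0 _ (z - y))// ?subr_gt0// -e subr_gt0.
Unshelve. all: by end_near. Qed.

(** If [D 0] were negative at [x], then, being [0] at [1] and at infinity, it would fall before [x]
    and rise after it, against the decrease of the likelihood ratio. *)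
Lemma beta_prime_cdf_antitone (x : R) : 1 <= x -> F2 x <= F1 x.
Proof.
have [F11 _ _ _] := F1P; have [F21 _ _ _] := F2P.
rewrite le_eqVlt => /predU1P[<-|x1]; first by rewrite F11 F21.
rewrite leNgt; apply/negP => F12.
have Dx : D 0 x < 0 by rewrite /D subr0 subr_lt0.
have [||z xz rz] := D_lt0_rises 0 x _ _ Dx => //; first by rewrite add0r.
have h : 0 + 1 < x by rewrite add0r.
have [y hy e] := @is_derive_MVT_right _ (D 0) (dD 0) _ _ h (cvg_D_right 0 (lexx 0))
  (fun x hx => is_derive_D 0 x (lexx 0) ltac:(lra)).
have ry : log_ratio a1 k1 a2 k2 0 y < 0.
  rewrite -dD_lt0 -(@pmulr_llt0 _ (x - (0 + 1))) ?subr_gt0// -e.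
  by rewrite {2}/D subr0 add0r F11 F21 !subr0.
have := @log_ratio_decreasing _ a1 k1 a2 k2 y z a1_gt0 a12 ltac:(lra) ltac:(lra).
lra.
Qed.

(** Otherwise there are [x0 < x1 < z] where the log-ratio is nonnegative, negative and positive:
    [D c] climbs from a nonpositive value at [c + 1] to [0] at [x], falls by [y], and rises again
    later. This contradicts quasi-concavity. *)
Let D_crossing (c x y : R) : 0 <= c -> c + 1 < x -> x < y -> D c x = 0 -> 0 <= D c y.
Proof.
move=> c0 cx xy Dx; rewrite leNgt; apply/negP => Dy.
have [F11 _ _ _] := F1P; have [F21 _ _ _] := F2P.
have [||z yz rz] := D_lt0_rises c y _ _ Dy => //; first lra.
have [x0 hx0 e0] := @is_derive_MVT_right _ (D c) (dD c) _ _ cx (cvg_D_right c c0)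
  (fun x hx => is_derive_D c x c0 ltac:(lra)).
have r0 : 0 <= log_ratio a1 k1 a2 k2 c x0.
  rewrite leNgt -dD_lt0 -(@pmulr_llt0 _ (x - (c + 1))) ?subr_gt0// -e0 Dx sub0r.
  rewrite oppr_lt0 /D addrAC subrr add0r F11 sub0r oppr_gt0 -leNgt -F21.
  have [->|c0'] := eqVneq c 0; first by rewrite add0r.
  apply/ltW/(beta_prime_cdf_lt _ _ F2P) => //.
  by rewrite ltrDr lt_neqAle eq_sym c0'.
have [x1 hx1 e1] := @is_derive_MVT _ (D c) (dD c) _ _ xy
  (fun x hx => is_derive_D c x c0 ltac:(lra)).
have r1 : log_ratio a1 k1 a2 k2 c x1 < 0.
  by rewrite -dD_lt0 -(@pmulr_llt0 _ (y - x)) ?subr_gt0// -e1 Dx subr0.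
have := @log_ratio_quasiconcave _ a1 k1 a2 k2 c x0 x1 z a1_gt0 a12 c0
  ltac:(lra) ltac:(lra) ltac:(lra) ltac:(lra).
lra.
Qed.

Lemma beta_prime_cdf_disp (x1 y1 x2 y2 : R) : 1 < x1 -> 1 < x2 -> x2 < y2 ->
  F1 x1 = F2 x2 -> F1 y1 = F2 y2 -> y1 - x1 <= y2 - x2.
Proof.
move=> x1_gt1 x2_gt1 xy2 ex ey; rewrite leNgt; apply/negP => h.
have c0 : 0 <= x2 - x1.
  rewrite subr_ge0 leNgt; apply/negP => x21.
  have := beta_prime_cdf_lt _ _ F1P (ltW x2_gt1) x21.
  by rewrite ex ltNge beta_prime_cdf_antitone// ltW.
(* With [c = x2 - x1], [D c] vanishes at [x2], while the assumed violation reads [y2 - c < y1] and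
   makes [D c y2] negative. *)
have := @D_crossing (x2 - x1) x2 y2 c0 ltac:(lra) xy2.
rewrite /D subKr ex subrr => /(_ erefl).
apply/negP; rewrite -ltNge subr_lt0 -ey.
by apply: (beta_prime_cdf_lt _ _ F1P); lra.
Qed.

End dispersion.

(** * The law of the ratio *)

Section density.
Local Open Scope ereal_scope.
Context d (T : measurableType d) (R : realType).
Variables (nu mu : {measure set T -> \bar R}) (f : T -> R).
Hypotheses (mf : measurable_fun setT f) (f0 : forall x, (0 <= f x)%R).
Hypothesis nuE : forall A, measurable A -> nu A = \int[mu]_(x in A) (f x)%:E.

Import HBNNSimple.

Let integral_density_nnsfun (g : {nnsfun T >-> R}) :
  \int[nu]_x (g x)%:E = \int[mu]_x ((g x)%:E * (f x)%:E).
Proof.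
under [LHS]eq_integral do rewrite fimfunE -fsumEFin//.
rewrite [LHS]ge0_integral_fsum//; last 2 first.
- by move=> r; exact/measurable_EFinP/measurableT_comp.
- by move=> n x _; rewrite EFinM nnfun_muleindic_ge0.
under [RHS]eq_integral.
  move=> x xD; rewrite fimfunE -fsumEFin// muleC ge0_mule_fsumr; last first.
    by move=> r; rewrite EFinM nnfun_muleindic_ge0.
  over.
rewrite [RHS]ge0_integral_fsum//; last 2 first.
- move=> r; apply: emeasurable_funM; apply/measurable_EFinP => //.
  exact/measurableT_comp.
- move=> r x _; apply: mule_ge0; first by rewrite lee_fin.
  by rewrite EFinM nnfun_muleindic_ge0.
apply: eq_fsbigr => r _.
rewrite integralZl_indic_nnsfun// integral_indic// setIT nuE//.
under [RHS]eq_integral do rewrite muleC EFinM -muleA.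
(* A negative [r] is not a value of [g], so both sides vanish. *)
have [r0|r0] := leP 0%R r.
  rewrite ge0_integralZl//; last 2 first.
  - by apply: emeasurable_funM; exact/measurable_EFinP.
  - by move=> x _; rewrite mule_ge0 ?lee_fin.
  rewrite integral_mkcond; congr (_ * _); apply: eq_integral => x _.
  by rewrite epatch_indic muleC.
rewrite preimage_nnfun0// integral_set0 mule0 integral0_eq// => x _.
by rewrite indic0 mul0e mule0.
Qed.

Lemma ge0_integral_density (g : T -> \bar R) :
  measurable_fun setT g -> (forall x, 0 <= g x) ->
  \int[nu]_x g x = \int[mu]_x (g x * (f x)%:E).
Proof.
move=> mg g0; pose g_ := nnsfun_approx measurableT mg.
transitivity (limn (fun n => \int[nu]_x (g_ n x)%:E)).
  rewrite -monotone_convergence//=.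
  - apply: eq_integral => x _; apply/esym/cvg_lim => //.
    exact: cvg_nnsfun_approx.
  - by move=> n; exact/measurable_EFinP/measurable_funTS.
  - by move=> n ? _; rewrite lee_fin.
  - by move=> ? _ ? ? mn; rewrite lee_fin; exact/lefP/nd_nnsfun_approx.
under eq_fun do rewrite integral_density_nnsfun.
rewrite -monotone_convergence//=.
- apply: eq_integral => x _; apply/cvg_lim => //; apply: cvgeZr => //.
  exact: cvg_nnsfun_approx.
- by move=> n; apply: emeasurable_funM; exact/measurable_EFinP.
- by move=> n ? _; rewrite mule_ge0// lee_fin.
- move=> ? _ ? ? mn; rewrite lee_wpmul2r ?lee_fin//.
  exact/lefP/nd_nnsfun_approx.
Qed.

End density.

Section scaling.
Local Open Scope ereal_scope.
Context {R : realType}.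
Local Notation mu := (@lebesgue_measure R).

(** Pushing Lebesgue measure forward by [x |-> c x] and multiplying by [c] gives a measure that
    agrees with it on half-open intervals, hence everywhere. *)
Lemma ge0_integral_scale (c : R) (f : R -> \bar R) : (0 < c)%R ->
  measurable_fun setT f -> (forall x, 0 <= f x) ->
  \int[mu]_x f x = c%:E * \int[mu]_x f (c * x)%R.
Proof.
move=> c0 mf f0.
have mc : measurable_fun setT ( *%R c : measurableTypeR R -> measurableTypeR R).
  exact: mulrl_measurable.
pose cnn : {nonneg R} := NngNum (ltW c0).
rewrite -(@ge0_integral_pushforward _ _ _ _ _ _ mc mu setT f)//.
rewrite -(ge0_integral_mscale _ _ cnn)//.
apply: eq_measure_integral => A mA _.
apply: lebesgue_measure_unique => // _ [[a b]] _ <-.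
transitivity (c%:E * mu ( *%R c @^-1` `]a, b])) => //.
rewrite (_ : _ @^-1` _ = `](a / c)%R, (b / c)%R]%classic); last first.
  by apply/seteqP; split=> x /=; rewrite !in_itv/= ltr_pdivrMr// ler_pdivlMr//
    !(mulrC x).
rewrite !lebesgue_measure_itv/= !lte_fin ltr_pM2r ?invr_gt0//.
case: ifPn => _; last by rewrite mule0.
by rewrite -!EFinB -EFinM; congr EFin; field; rewrite gt_eqF.
Qed.

End scaling.

Lemma ge0_integral_has_pdf d (T : measurableType d) (R : realType)
    (P : probability T R) (X : {RV P >-> R}) (f : R -> R) (g : R -> \bar R) :
  measurable_fun setT f -> (forall x, 0 <= f x) -> has_pdf X f ->
  measurable_fun setT g -> (forall x, 0 <= g x)%E ->
  (\int[P]_w g (X w) = \int[lebesgue_measure]_x (g x * (f x)%:E))%E.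
Proof.
move=> mf f0 Xf mg g0.
have mX : measurable_fun setT (X : T -> measurableTypeR R).
  exact: measurable_funP X.
transitivity (\int[pushforward P (X : T -> measurableTypeR R)]_x g x)%E.
  by rewrite (@ge0_integral_pushforward _ _ _ _ _ _ mX P setT g).
exact: ge0_integral_density.
Qed.

(** * Quotient of two independent positive variables *)

Section independent_pair.
Local Open Scope ereal_scope.
Context d (T : measurableType d) (R : realType) (P : probability T R).
Variables (X Y : {RV P >-> R}) (f : R -> R).
Hypotheses (mf : measurable_fun setT f) (f0 : forall x, (0 <= f x)%R).
Hypotheses (Xf : has_pdf X f) (Yf : has_pdf Y f).
Hypothesis indep : forall A B : set R, measurable A -> measurable B ->
  P (X @^-1` A `&` Y @^-1` B) = P (X @^-1` A) * P (Y @^-1` B).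
Local Notation mu := (@lebesgue_measure R).

(** By independence the joint law agrees with the product measure on rectangles, hence everywhere.
    The denominator [Y] comes first, so that the sections of [C] are taken at a fixed value of
    it. *)
Lemma independent_pair_law (C : set (R * R)) : measurable C ->
  P [set w | C (Y w, X w)] =
  \int[mu]_y ((\int[mu]_(x in xsection C y) (f x)%:E) * (f y)%:E).
Proof.
move=> mC.
have mYX : measurable_fun setT (fun w => (Y w, X w)).
  by apply: measurable_fun_pair; exact: measurable_funP.
have : (distribution P Y \x distribution P X) C =
    pushforward P (fun w => (Y w, X w)) C.
  apply: product_measure_unique mC => A B mA mB.
  by rewrite /pushforward/= muleC -indep// setIC.
rewrite /pushforward /preimage/= => <-.
rewrite /product_measure1 ge0_integral_distribution//.
- rewrite (@ge0_integral_has_pdf _ _ _ _ Y f (distribution P X \o xsection C))//.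
  apply: eq_integral => y _; congr (_ * _); rewrite /= Xf//.
  exact: measurable_xsection.
  exact: measurable_fun_xsection.
- exact: measurable_fun_xsection.
Qed.

Hypothesis f_eq0 : forall x, (x <= 0)%R -> f x = 0%R.

(** For fixed [y > 0] the substitution [x = y s] in the inner integral produces the factor [y];
    Tonelli then exchanges the two integrals. *)
Lemma ratio_law (B : set R) : measurable B ->
  P [set w | (0 < Y w)%R /\ B (X w / Y w)%R] =
  \int[mu]_(s in B) \int[mu]_y (f (y * s) * (y * f y))%:E.
Proof.
move=> mB.
(* The power of exponent [-1] is measurable by [measurable_powR] and is the inverse on the positive
   half-line, to which [C] confines the first coordinate. *)
pose q (z : R * R) := (z.2 * z.1 `^ (-1))%R.
have mq : measurable_fun setT q.
  apply: measurable_funM; first exact: measurable_snd.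
  exact: (measurableT_comp (measurable_powR _) measurable_fst).
pose C := (fst @^-1` `]0%R, +oo[ `&` q @^-1` B : set (R * R)).
have mC : measurable C.
  apply: measurableI; rewrite -[X in measurable X]setTI.
    exact: measurable_fst.
  exact: mq.
rewrite (_ : [set w | _] = [set w | C (Y w, X w)]); last first.
  apply/seteqP; split=> w; rewrite /C /q /= in_itv/= andbT => -[Y0].
    by rewrite powR_inv1 ?ltW.
  by rewrite powR_inv1 ?ltW.
rewrite independent_pair_law//.
pose h (z : R * R) := ((f (z.1 * z.2) * (z.1 * f z.1)) * \1_B z.2)%:E.
have h0 z : 0 <= h z.
  rewrite lee_fin mulr_ge0// mulr_ge0//.
  have [z0|z0] := leP z.1 0%R; first by rewrite f_eq0// mulr0.
  by rewrite mulr_ge0// ltW.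
have mh : measurable_fun setT h.
  apply/measurable_EFinP; apply: measurable_funM; last first.
    by apply: measurableT_comp.
  apply: measurable_funM.
    by apply: measurableT_comp => //; exact: measurable_funM.
  by apply: measurable_funM => //; exact: measurableT_comp.
transitivity (\int[mu]_y \int[mu]_s h (y, s)); last first.
  rewrite (@fubini_tonelli _ _ (measurableTypeR R) (measurableTypeR R) R mu mu h)// [RHS]integral_mkcond.
  apply: eq_integral => s _; rewrite patchE.
  case: ifPn => sB; last first.
    by rewrite integral0_eq// => y _; rewrite /h/= indicE (negbTE sB) mulr0.
  by apply: eq_integral => y _; rewrite /h/= indicE sB mulr1.
apply: eq_integral => y _.
have [y0|y0] := leP y 0%R.
  rewrite (f_eq0 _ y0) mule0 integral0_eq// => s _.
  by rewrite /h/= (f_eq0 _ y0) !mulr0 mul0r.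
have mg : measurable_fun setT ((fun x => (f x)%:E) \_ (xsection C y)).
  apply: (iffLR (measurable_restrictT _ (measurable_xsection _ mC))).
  exact/measurable_funTS/measurable_EFinP.
rewrite integral_mkcond [X in X * _](@ge0_integral_scale _ y)//; last first.
  by move=> x; apply: erestrict_ge0 => z _; rewrite lee_fin.
rewrite muleAC -EFinM -ge0_integralZl//; last 3 first.
- exact: (measurableT_comp mg (mulrl_measurable y)).
- by move=> x _; apply: erestrict_ge0 => z _; rewrite lee_fin.
- by rewrite lee_fin mulr_ge0// ltW.
apply: eq_integral => s _; rewrite patchE /h/= indicE.
rewrite (_ : (_ \in xsection C y) = (s \in B)); last first.
  rewrite mem_xsection; apply/idP/idP; rewrite !inE /C /q/= in_itv/= y0/=.
    by case=> _; rewrite powR_inv1 ?ltW// mulrAC divff ?gt_eqF// mul1r.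
  by move=> sB; split => //; rewrite powR_inv1 ?ltW// mulrAC divff ?gt_eqF// mul1r.
case: ifPn => _; last by rewrite mule0 mulr0.
by rewrite mulr1 -EFinM mulrC.
Qed.

End independent_pair.

(** * Quotient of two gamma variables *)

Section gamma_ratio.
Context {R : realType} (a l : R).
Local Notation mu := (@lebesgue_measure R).
Local Notation f := (gamma_pdf a l).

Let C := (gamma_fun a * l `^ a)^-1.

Let C_ge0 : 0 <= C.
Proof.
rewrite invr_ge0 mulr_ge0 ?powR_ge0// /gamma_fun Rintegral_ge0// => x _.
by rewrite mulr_ge0 ?powR_ge0 ?expR_ge0.
Qed.

Let gt0_powRE (x r : R) : 0 < x -> x `^ r = expR (r * ln x).
Proof. by move=> x0; rewrite /powR gt_eqF. Qed.

Lemma gamma_pdfE (x : R) : 0 < x -> f x = C * expR ((a - 1) * ln x - x / l).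
Proof.
move=> x0; rewrite /gamma_pdf patchE mem_set/= ?in_itv/= ?x0//.
by rewrite /= (gt0_powRE x)// -mulrA -expRD.
Qed.

Lemma gamma_pdf_le0 (x : R) : x <= 0 -> f x = 0.
Proof.
by move=> x0; rewrite /gamma_pdf patchE memNset//= in_itv/= andbT ltNge x0.
Qed.

Lemma gamma_pdf_ge0 (x : R) : 0 <= f x.
Proof.
have [x0|x0] := leP x 0; first by rewrite gamma_pdf_le0.
by rewrite gamma_pdfE// mulr_ge0 ?expR_ge0.
Qed.

Lemma measurable_gamma_pdf : measurable_fun setT f.
Proof.
apply: (iffLR (measurable_restrictT _ (measurable_itv _))).
apply/measurable_funTS/measurable_funM.
  by apply: measurable_funM => //; exact: measurable_powR.
apply: measurableT_comp => //; apply: measurableT_comp => //.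
exact: measurable_funM.
Qed.

(* Up to a constant, the density of the ratio of two independent gamma variables
   of shape [a] and equal scales. *)
Definition ratio_density (s : R) : R :=
  ((fun s => expR ((a - 1) * ln s - 2 * a * ln (1 + s))) \_ `]0, +oo[) s.

Lemma ratio_densityE (s : R) : 0 < s ->
  ratio_density s = expR ((a - 1) * ln s - 2 * a * ln (1 + s)).
Proof.
by move=> s0; rewrite /ratio_density patchE mem_set//= in_itv/= s0.
Qed.

Lemma ratio_density_le0 (s : R) : s <= 0 -> ratio_density s = 0.
Proof.
by move=> s0; rewrite /ratio_density patchE memNset//= in_itv/= andbT ltNge s0.
Qed.

Lemma ratio_density_ge0 (s : R) : 0 <= ratio_density s.
Proof.
have [s0|s0] := leP s 0; first by rewrite ratio_density_le0.
by rewrite ratio_densityE// expR_ge0.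
Qed.

Lemma measurable_ratio_density : measurable_fun setT ratio_density.
Proof.
apply: (iffLR (measurable_restrictT _ (measurable_itv _))).
apply: measurable_funTS; apply: measurableT_comp => //.
apply: measurable_funB.
  by apply: measurable_funM => //; exact: measurable_ln.
apply: measurable_funM => //; apply: (measurableT_comp (@measurable_ln R)).
exact: measurable_funD.
Qed.

(** Up to a constant, the gamma density of shape [2 * a], which is the law of the sum of the two
    variables. *)
Let psi (z : R) : R :=
  ((fun z => C ^+ 2 * expR ((2 * a - 1) * ln z - z / l)) \_ `]0, +oo[) z.

Let psi_ge0 z : 0 <= psi z.
Proof.
rewrite /psi patchE; case: ifP => // _.
by rewrite mulr_ge0 ?expR_ge0 ?sqr_ge0.
Qed.

Let measurable_psi : measurable_fun setT psi.
Proof.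
apply: (iffLR (measurable_restrictT _ (measurable_itv _))).
apply: measurable_funTS; apply: measurable_funM => //.
apply: measurableT_comp => //; apply: measurable_funB.
  by apply: measurable_funM => //; exact: measurable_ln.
exact: measurable_funM.
Qed.

(** The exponentials combine into a function of [(1 + s) * y], so the integrand separates; after
    rescaling, the integral over [y] no longer depends on [s]. *)
Let gamma_pdf_mul (y s : R) : 0 < s ->
  f (y * s) * (y * f y) = ratio_density s * ((1 + s) * psi ((1 + s) * y)).
Proof.
move=> s0; have s1 : 0 < 1 + s by lra.
rewrite /psi patchE; have [y0|y0] := leP y 0.
  rewrite gamma_pdf_le0 ?mul0r; last by rewrite pmulr_lle0.
  by rewrite memNset ?mulr0//= in_itv/= andbT pmulr_rgt0// ltNge y0.
rewrite mem_set/=; last by rewrite in_itv/= andbT mulr_gt0.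
rewrite ratio_densityE// !gamma_pdfE ?mulr_gt0//.
transitivity (C ^+ 2 * expR (ln y + ((a - 1) * ln (y * s) - y * s / l)
    + ((a - 1) * ln y - y / l))).
  by rewrite !expRD lnK ?posrE//; ring.
transitivity (C ^+ 2 * expR (ln (1 + s) + ((a - 1) * ln s - 2 * a * ln (1 + s))
    + ((2 * a - 1) * ln ((1 + s) * y) - (1 + s) * y / l))); last first.
  by rewrite !expRD lnK ?posrE//; ring.
congr (_ * expR _); rewrite !lnM ?posrE//; ring.
Qed.

(** The constant is the integral of [psi], left extended real: its finiteness is deduced later from
    the total mass. *)
Lemma gamma_ratio_kernel : exists2 k : \bar R, (0 <= k)%E &
  forall s, (\int[mu]_y (f (y * s) * (y * f y))%:E)%E
    = (k * (ratio_density s)%:E)%E.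
Proof.
exists (\int[mu]_z (psi z)%:E)%E.
  by apply: integral_ge0 => z _; rewrite lee_fin.
move=> s; have [s0|s0] := leP s 0.
  rewrite ratio_density_le0// mule0 integral0_eq// => y _.
  have [y0|y0] := leP y 0; first by rewrite (gamma_pdf_le0 _ y0) !mulr0.
  by rewrite gamma_pdf_le0 ?mul0r// pmulr_rle0.
have s1 : 0 < 1 + s by lra.
have mpsi : measurable_fun setT (fun z => (psi z)%:E).
  exact/measurable_EFinP.
rewrite (@ge0_integral_scale _ (1 + s) (fun z => (psi z)%:E))//.
rewrite muleAC -EFinM -ge0_integralZl//; last 3 first.
- exact: (measurableT_comp mpsi (mulrl_measurable _)).
- by move=> y _; rewrite lee_fin.
- by rewrite lee_fin mulr_ge0 ?ratio_density_ge0// ltW.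
by apply: eq_integral => y _; rewrite gamma_pdf_mul// -EFinM; congr EFin; ring.
Qed.

End gamma_ratio.

Section gamma_ratio_law.
Context d (T : measurableType d) (R : realType) (P : probability T R).
Context (a l : R) (X Y : {RV P >-> R}).
Hypotheses (Xf : has_pdf X (gamma_pdf a l)) (Yf : has_pdf Y (gamma_pdf a l)).
Hypothesis indep : forall A B : set R, measurable A -> measurable B ->
  P (X @^-1` A `&` Y @^-1` B) = (P (X @^-1` A) * P (Y @^-1` B))%E.
Local Notation mu := (@lebesgue_measure R).

Lemma has_gamma_pdf_gt0 : P [set w | 0 < Y w] = 1%E.
Proof.
transitivity (distribution P Y `]0, +oo[).
  by congr (P _); apply/seteqP; split=> w /=; rewrite in_itv/= andbT.
transitivity (distribution P Y setT); last exact: probability_setT.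
rewrite (Yf _ (measurable_itv _)) (Yf _ measurableT).
rewrite integral_mkcond; apply: eq_integral => x _.
rewrite patchE; case: ifPn => //; rewrite notin_setE/= in_itv/= andbT.
by move/negP; rewrite -leNgt => /gamma_pdf_le0 ->.
Qed.

Lemma gamma_ratio_law : exists k : R, [/\ 0 < k,
  mu.-integrable setT (fun s => (k * ratio_density a s)%:E) &
  forall B : set R, measurable B ->
    P [set w | 0 < Y w /\ B (X w / Y w)] =
    (\int[mu]_(s in B) (k * ratio_density a s)%:E)%E].
Proof.
have [k k0 kE] := gamma_ratio_kernel a l.
have mrd := measurable_ratio_density a.
have law (B : set R) : measurable B -> P [set w | 0 < Y w /\ B (X w / Y w)] =
    (k * \int[mu]_(s in B) (ratio_density a s)%:E)%E.
  move=> mB; rewrite (@ratio_law _ _ _ _ X Y (gamma_pdf a l))//.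
  - rewrite -ge0_integralZl//; last 2 first.
    + exact/measurable_funTS/measurable_EFinP.
    + by move=> s _; rewrite lee_fin ratio_density_ge0.
    by apply: eq_integral => s _; rewrite kE.
  - exact: measurable_gamma_pdf.
  - exact: gamma_pdf_ge0.
  - by move=> x /gamma_pdf_le0 ->.
(* Total mass [1] forces [k] to be neither [0] nor infinite and the integral of [ratio_density] to
   be finite. *)
have := law setT measurableT.
rewrite (_ : [set w | _] = [set w | 0 < Y w]); last first.
  by apply/seteqP; split=> w //= [].
rewrite has_gamma_pdf_gt0.
have I0 : (0 <= \int[mu]_s (ratio_density a s)%:E)%E.
  by apply: integral_ge0 => s _; rewrite lee_fin ratio_density_ge0.
move: k k0 kE law I0 => [k| |]//; rewrite ?lee_fin => k0 kE law I0 I1.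
- have k_gt0 : 0 < k.
    rewrite lt_neqAle k0 andbT; apply/eqP => k00.
    by move: I1; rewrite -k00 mul0e => /eqP; rewrite onee_eq0.
  have lawk (B : set R) : measurable B ->
      (\int[mu]_(s in B) (k * ratio_density a s)%:E =
       k%:E * \int[mu]_(s in B) (ratio_density a s)%:E)%E.
    move=> mB; rewrite -ge0_integralZl//.
    + exact/measurable_funTS/measurable_EFinP.
    + by move=> s _; rewrite lee_fin ratio_density_ge0.
  exists k; split => //; last by move=> B mB; rewrite lawk// law.
  apply/integrableP; split.
    by apply/measurable_EFinP; exact: measurable_funM.
  under eq_integral do rewrite gee0_abs ?lee_fin ?mulr_ge0 ?ratio_density_ge0//.
  by rewrite lawk// -I1 ltry.
- have [I00|I00] := eqVneq (\int[mu]_s (ratio_density a s)%:E)%E 0%E.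
    by move: I1; rewrite I00 mule0 => /eqP; rewrite onee_eq0.
  by move: I1; rewrite gt0_mulye// lt0e I00.
Qed.

End gamma_ratio_law.

(** * The law of the estimator *)

Lemma measurable_ratio_event d (T : measurableType d) (R : realType)
    (X Y : {mfun T >-> R}) (B : set R) : measurable B ->
  measurable [set w | 0 < Y w /\ B (X w / Y w)].
Proof.
move=> mB.
have mq : measurable_fun setT (fun w => X w * Y w `^ (-1)).
  by apply: measurable_funM => //; exact: (measurableT_comp (measurable_powR _)).
rewrite (_ : mkset _ =
    Y @^-1` `]0, +oo[ `&` (fun w => X w * Y w `^ (-1)) @^-1` B).
  apply: measurableI; rewrite -[X in measurable X]setTI; last exact: mq.
  exact: measurable_funP.
apply/seteqP; split=> w; rewrite /= in_itv/= andbT => -[Y0].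
  by rewrite powR_inv1 ?ltW.
by rewrite powR_inv1 ?ltW.
Qed.

Lemma eq_measure_off d (T : measurableType d) (R : realType)
    (P : {measure set T -> \bar R}) (N U V : set T) :
  measurable N -> measurable U -> measurable V -> P N = 0%E ->
  (forall w, ~ N w -> U w <-> V w) -> P U = P V.
Proof.
move=> mN mU mV N0 UV.
have PD W : measurable W -> P W = P (W `\` N).
  move=> mW; rewrite (measureDI P mW mN) -[RHS]adde0; congr (_ + _)%E.
  apply: (subset_measure0 _ mN _ N0); first exact: measurableI.
  exact: subIsetr.
rewrite (PD U mU) (PD V mV); congr (P _).
by apply/seteqP; split=> w [Uw Nw]; split => //; apply/(UV w).
Qed.

Lemma mutually_independent_pair d (T : measurableType d) (R : realType)
    (P : probability T R) n (X : 'I_n -> {RV P >-> R}) (i j : 'I_n) :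
  mutually_independent X -> i != j ->
  forall A B : set R, measurable A -> measurable B ->
  P (X i @^-1` A `&` X j @^-1` B) = (P (X i @^-1` A) * P (X j @^-1` B))%E.
Proof.
move=> Xind ij A B mA mB.
pose E k := if k == i then A else B.
have mE k : k \in [set i; j]%SET -> measurable (E k).
  by move=> _; rewrite /E; case: ifP.
have := Xind [set i; j]%SET E mE.
rewrite big_setU1/= ?inE// big_set1 /E eqxx eq_sym (negbTE ij) => <-.
congr (P _); apply/seteqP; split=> [w [Aw Bw] k|w h].
  by rewrite /= !inE => /orP[|] /eqP ->; rewrite ?eqxx// eq_sym (negbTE ij).
split.
  by have := h i; rewrite /= !inE eqxx => /(_ isT).
by have := h j; rewrite /= !inE eqxx orbT eq_sym (negbTE ij) => /(_ isT).
Qed.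

Lemma moment_estimator2E d (T : measurableType d) (R : realType)
    (P : probability T R) (X : 'I_2 -> {RV P >-> R}) w :
  moment_estimator X w =
  (X ord0 w + X ord_max w) ^+ 2 / (X ord0 w - X ord_max w) ^+ 2.
Proof.
rewrite /moment_estimator/= /moment_estimator_fun /sample_variance /sample_mean.
rewrite !big_ord_recl !big_ord0 !addr0.
rewrite (_ : lift ord0 ord0 = ord_max); last exact/val_inj.
set x := X ord0 w; set y := X ord_max w.
rewrite (_ : 2%:R^-1 * (_ ^+ 2 + _ ^+ 2) = 4^-1 * (x - y) ^+ 2); last by field.
(* With the inverse kept opaque, the identity also covers [x = y], where both sides are [0]. *)
rewrite exprMn invfM invrK; set v := ((x - y) ^+ 2)^-1.
by field.
Qed.

(** The solution [r] in [[0, 1)] of [((1 + r) / (1 - r)) ^ 2 = z], for [z >= 1]. *)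
Definition ratio_bound {R : realType} (z : R) : R :=
  (Num.sqrt z - 1) / (Num.sqrt z + 1).

Lemma ratio_bound_itv {R : realType} (z : R) : 1 <= z ->
  0 <= ratio_bound z < 1.
Proof.
move=> z1; have q1 : 1 <= Num.sqrt z by rewrite -sqrtr1 ler_sqrt//; lra.
rewrite /ratio_bound; apply/andP; split; first by rewrite divr_ge0//; lra.
by rewrite ltr_pdivrMr; lra.
Qed.

(** Taking square roots, the inequality becomes [x + y <= sqrt z * |x - y|]; the sign of [x - y]
    selects the ratio that can satisfy its bound. *)
Lemma le_ratio_bound {R : realType} (x y z : R) : 0 < x -> 0 < y -> x != y ->
  1 <= z ->
  (x + y) ^+ 2 / (x - y) ^+ 2 <= z <->
  x / y <= ratio_bound z \/ y / x <= ratio_bound z.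
Proof.
move=> x0 y0 xy z1; have q1 : 1 <= Num.sqrt z by rewrite -sqrtr1 ler_sqrt//; lra.
have h (u v : R) : 0 < v ->
    (u / v <= ratio_bound z) = (u + v <= Num.sqrt z * (v - u)).
  move=> v0; rewrite /ratio_bound ler_pdivrMr// mulrAC ler_pdivlMr; last lra.
  by apply/idP/idP => ?; nra.
rewrite !h//.
have -> : ((x + y) ^+ 2 / (x - y) ^+ 2 <= z) = (x + y <= Num.sqrt z * `|x - y|).
  rewrite ler_pdivrMr; last by rewrite exprn_even_gt0//= subr_eq0.
  rewrite -{1}(@sqr_sqrtr _ z); last lra.
  rewrite -[X in _ * X]real_normK ?num_real// -exprMn ler_sqr ?nnegrE; [|lra|].
    by [].
  by rewrite mulr_ge0//; lra.
have [h0|h0|h0] := ltgtP x y; last by rewrite h0 eqxx in xy.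
- rewrite ltr0_norm ?subr_lt0// opprB; split; first by left.
  by case=> // ?; nra.
- rewrite gtr0_norm ?subr_gt0//; split; first by rewrite [y + x]addrC; right.
  by rewrite [y + x]addrC; case=> // ?; nra.
Qed.

Lemma has_gamma_pdf_le0 d (T : measurableType d) (R : realType)
    (P : probability T R) (a l : R) (X : {RV P >-> R}) :
  has_pdf X (gamma_pdf a l) -> P (X @^-1` `]-oo, 0]) = 0%E.
Proof.
move=> /(_ _ (measurable_itv `]-oo, 0])) h; rewrite [LHS]h.
rewrite integral0_eq// => x; rewrite /= in_itv/= => /gamma_pdf_le0 -> //.
Qed.

(** Off a null set the event is the disjoint union of two events, one for each of the ratios
    [X1 / X2] and [X2 / X1]; their constants are simply added. *)
Lemma moment_estimator_cdf d (T : measurableType d) (R : realType)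
    (P : probability T R) (a l : R) (X : 'I_2 -> {RV P >-> R}) :
  random_sample (gamma_pdf a l) X ->
  exists k : R, [/\ 0 < k,
    lebesgue_measure.-integrable setT (fun s => (k * ratio_density a s)%:E) &
    forall z, 1 <= z -> cdf (moment_estimator X) z =
      (\int[lebesgue_measure]_(s in `]-oo, ratio_bound z])
         (k * ratio_density a s)%:E)%E].
Proof.
move=> [Xind Xpdf].
have n01 : (ord0 : 'I_2) != ord_max by [].
have n10 : (ord_max : 'I_2) != ord0 by [].
have [k1 [k10 i1 law1]] := gamma_ratio_law _ _ _ _ _ _ _ _ (Xpdf ord0)
  (Xpdf ord_max) (mutually_independent_pair _ _ _ _ _ _ _ _ Xind n01).
have [k2 [k20 i2 law2]] := gamma_ratio_law _ _ _ _ _ _ _ _ (Xpdf ord_max)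
  (Xpdf ord0) (mutually_independent_pair _ _ _ _ _ _ _ _ Xind n10).
have iE : (fun s => ((k1 + k2) * ratio_density a s)%:E) =
    (fun s => (k1 * ratio_density a s)%:E + (k2 * ratio_density a s)%:E)%E.
  by apply/funext => s; rewrite mulrDl.
exists (k1 + k2); split; first exact: addr_gt0.
  by rewrite iE; exact: integrableD.
move=> z z1; have /andP[b0 b1] := ratio_bound_itv z z1.
have mb : measurable (`]-oo, ratio_bound z]%classic : set R).
  exact: measurable_itv.
rewrite iE integralD//=; last 2 first.
- by apply: integrableS i1.
- by apply: integrableS i2.
rewrite -law1// -law2//.
set x := X ord0; set y := X ord_max.
pose A1 := [set w | 0 < y w /\ `]-oo, ratio_bound z]%classic (x w / y w)].
pose A2 := [set w | 0 < x w /\ `]-oo, ratio_bound z]%classic (y w / x w)].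
have mA1 : measurable A1 by exact: measurable_ratio_event.
have mA2 : measurable A2 by exact: measurable_ratio_event.
have m1 : measurable ([set 1] : set R) by exact: measurable_set1.
(* Equal observations have to be excluded: there the estimator takes the default value [0]. They
   form a null set because the ratio has a density. *)
pose N1 := [set w | 0 < y w /\ [set (1 : R)] (x w / y w)].
have mN1 : measurable N1 by exact: (measurable_ratio_event _ _ _ x y _ m1).
have N10 : P N1 = 0%E.
  by rewrite [LHS](law1 _ m1) integral_set1.
pose N := x @^-1` `]-oo, 0] `|` (y @^-1` `]-oo, 0] `|` N1).
have mx0 : measurable (x @^-1` `]-oo, 0]).
  rewrite -[X in measurable X]setTI.
  exact: (measurable_funP x _ _ (measurable_itv `]-oo, 0])).
have my0 : measurable (y @^-1` `]-oo, 0]).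
  rewrite -[X in measurable X]setTI.
  exact: (measurable_funP y _ _ (measurable_itv `]-oo, 0])).
have mN : measurable N by do 2 apply: measurableU => //.
have N20 : P (y @^-1` `]-oo, 0] `|` N1) = 0%E.
  transitivity (P (y @^-1` `]-oo, 0])); first exact: measureU0.
  exact: has_gamma_pdf_le0 (Xpdf ord_max).
have N0 : P N = 0%E.
  transitivity (P (x @^-1` `]-oo, 0])); last exact: has_gamma_pdf_le0 (Xpdf ord0).
  by apply: measureU0 => //; exact: measurableU.
have mU : measurable (moment_estimator X @^-1` `]-oo, z]).
  rewrite -[X in measurable X]setTI.
  exact: (measurable_funP (moment_estimator X) _ _ (measurable_itv `]-oo, z])).
transitivity (P (A1 `|` A2)).
  apply: (eq_measure_off _ _ _ P N) => //; first exact: measurableU.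
  move=> w Nw; have x0 : 0 < x w.
    by rewrite ltNge; apply/negP => ?; apply: Nw; left; rewrite /= in_itv.
  have y0 : 0 < y w.
    by rewrite ltNge; apply/negP => ?; apply: Nw; right; left; rewrite /= in_itv.
  have xy : x w != y w.
    apply/eqP => xy; apply: Nw; right; right; split => //=.
    by rewrite xy divff// gt_eqF.
  have := le_ratio_bound _ _ _ x0 y0 xy z1; rewrite -moment_estimator2E => E.
  rewrite /A1 /A2 /setU/= !in_itv/=; split.
    by move=> /E [?|?]; [left|right].
  by move=> h; apply/E; case: h => -[]; [left|right].
(* Disjointness: since [ratio_bound z < 1], the two events would give both [x < y] and [y < x]. *)
apply: measureU => //; apply/seteqP; split=> w //=.
rewrite /A1 /A2 /= !in_itv/= => -[[y0 h1] [x0 h2]].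
move: h1 h2; rewrite !ler_pdivrMr// => h1 h2.
have : ratio_bound z * x w < x w by rewrite gtr_pMl.
have : ratio_bound z * y w < y w by rewrite gtr_pMl.
lra.
Qed.

Lemma continuous_ratio_density {R : realType} (a s : R) : 0 < s ->
  {for s, continuous (ratio_density a)}.
Proof.
move=> s0; rewrite /prop_for /continuous_at ratio_densityE//.
have cln (c : R) : 0 < c + s -> ln (c + t) @[t --> s] --> ln (c + s).
  move=> cs; apply: (@cvg_comp _ _ _ (fun t => c + t) (@ln R) _ (nbhs (c + s))).
    by apply: cvgD; [exact: cvg_cst|exact: cvg_id].
  exact: continuous_ln.
pose g t := expR ((a - 1) * ln (0 + t) - 2 * a * ln (1 + t)).
have -> : expR ((a - 1) * ln s - 2 * a * ln (1 + s)) = g s by rewrite /g add0r.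
have cg : g t @[t --> s] --> g s.
  apply: (@cvg_comp _ _ _ _ (@expR R) _
    (nbhs ((a - 1) * ln (0 + s) - 2 * a * ln (1 + s)))).
    apply: cvgB; apply: cvgM; [exact: cvg_cst| |exact: cvg_cst|]; apply: cln; lra.
  exact: continuous_expR.
apply: cvg_trans cg; apply: near_eq_cvg; near=> t.
have t0 : 0 < t by near: t; exact: (cvgr_gt _ cvg_id).
by rewrite ratio_densityE// /g add0r.
Unshelve. all: by end_near. Qed.

Lemma is_derive_ratio_bound {R : realType} (z : R) : 1 < z ->
  is_derive z 1 ratio_bound (Num.sqrt z * (Num.sqrt z + 1) ^+ 2)^-1.
Proof.
move=> z1; have q1 : 1 < Num.sqrt z by rewrite -sqrtr1 ltr_sqrt; lra.
have dq : is_derive z 1 (@Num.sqrt R) (2 * Num.sqrt z)^-1.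
  by apply: is_derive1_sqrt; lra.
have dn := is_deriveB dq (is_derive_cst (1 : R) z 1).
have dd := is_deriveD dq (is_derive_cst (1 : R) z 1).
have qn0 : ((@Num.sqrt R) + cst 1)%R z != 0.
  by rewrite /GRing.add/= gt_eqF//; lra.
have h := is_deriveM dn (is_deriveV qn0 dd).
apply: (@is_derive_eq _ _ _ _ _ _ _ _ h).
rewrite /GRing.scale/= subr0 addr0.
change ((Num.sqrt z - 1) * (- (Num.sqrt z + 1) ^- 2 / (2 * Num.sqrt z)) +
  (Num.sqrt z + 1)^-1 / (2 * Num.sqrt z) =
  (Num.sqrt z * (Num.sqrt z + 1) ^+ 2)^-1).
by field; apply/andP; split; lra.
Qed.

(** The density comes from the fundamental theorem of calculus for the ratio and the chain rule
    through [ratio_bound]; the limits at [1] and at infinity are general facts on distribution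
    functions. *)
Lemma beta_prime_cdf_moment_estimator d (T : measurableType d) (R : realType)
    (P : probability T R) (a l : R) (X : 'I_2 -> {RV P >-> R}) :
  random_sample (gamma_pdf a l) X ->
  exists k : R, beta_prime_cdf a k (fine \o cdf (moment_estimator X)).
Proof.
move=> /moment_estimator_cdf[k [k0 ik cdfE]].
pose Z := moment_estimator X.
have cdf_fin z : cdf Z z \is a fin_num by exact: fin_num_measure.
have F1 : fine (cdf Z 1) = 0.
  rewrite cdfE// integral0_eq// => s; rewrite /= in_itv/= /ratio_bound sqrtr1.
  by rewrite subrr mul0r => /ratio_density_le0 ->; rewrite mulr0.
(* The term in [ln 2] comes from [1 + ratio_bound z = 2 q / (q + 1)] with [q = sqrt z], raised to
   the power [- 2 a]. *)
exists (ln k - 2 * a * ln 2); split => //.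
- rewrite -F1; apply: fine_cvg; rewrite fineK//.
  exact: cdf_right_continuous.
- by apply: fine_cvg; exact: cvg_cdfy1.
move=> z z1.
pose H t := \int[lebesgue_measure]_(s in `]-oo, t]) (k * ratio_density a s).
have q1 : 1 < Num.sqrt z by rewrite -sqrtr1 ltr_sqrt; lra.
have b0 : 0 < ratio_bound z by rewrite /ratio_bound divr_gt0; lra.
have dH : is_derive (ratio_bound z) 1 H (k * ratio_density a (ratio_bound z)).
  have ub : ratio_bound z < ratio_bound z + 1 by rewrite ltrDl.
  have ci : {for ratio_bound z, continuous (fun s => k * ratio_density a s)}.
    by apply: cvgM; [exact: cvg_cst|exact: continuous_ratio_density].
  have iu : lebesgue_measure.-integrable `]-oo, (ratio_bound z + 1)]
      (EFin \o (fun s => k * ratio_density a s)) by apply: integrableS ik.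
  have [h1 h2] := @continuous_FTC1 R _ -oo%O _ _ ub iu (ltNyr _) ci.
  exact: (DeriveDef h1 (etrans (esym (derive1E _ _)) h2)).
have := is_derive1_comp dH (is_derive_ratio_bound z z1).
rewrite (_ : _ / _ = expR (log_density a (ln k - 2 * a * ln 2) z)).
  apply: near_eq_is_derive; near=> y.
  have y1 : 1 < y by near: y; exact: (cvgr_gt _ cvg_id).
  by rewrite /H /= cdfE ?ltW.
rewrite ratio_densityE// /log_density; set q := Num.sqrt z in q1 *.
have zE : z = q ^+ 2 by rewrite sqr_sqrtr//; lra.
have lnb : ln (ratio_bound z) = ln (q - 1) - ln (q + 1).
  by rewrite /ratio_bound -/q ln_div ?posrE; lra.
have ln1b : ln (1 + ratio_bound z) = ln 2 + ln q - ln (q + 1).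
  rewrite -lnM ?posrE//; [|lra].
  rewrite -ln_div ?posrE//; [|by rewrite mulr_gt0//; lra|lra].
  by congr ln; rewrite /ratio_bound -/q; field; lra.
have lnz : ln z = 2 * ln q by rewrite zE lnXn ?mulr_natl//; lra.
have lnz1 : ln (z - 1) = ln (q - 1) + ln (q + 1).
  by rewrite -lnM ?posrE//; [congr ln; rewrite zE; ring|lra|lra].
rewrite lnb ln1b lnz lnz1.
set A := (a - 1) * _ - _.
transitivity (expR (ln k + A - (ln q + 2 * ln (q + 1)))).
  have q0 : 0 < q by lra.
  have q10 : 0 < q + 1 by lra.
  rewrite expRD expRN expRD expRD (lnK k0) (lnK q0).
  by rewrite mulr_natl -lnXn// lnK// posrE exprn_gt0.
by rewrite /A; congr expR; field.
Unshelve. all: by end_near. Qed.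

(** * Quantiles of the estimator and conclusion *)

Lemma quantile_beta_prime d (T : measurableType d) (R : realType)
    (P : probability T R) (Z : {RV P >-> R}) (a k u : R) :
  beta_prime_cdf a k (fine \o cdf Z) -> 0 < u < 1 ->
  1 < quantile Z u /\ (fine \o cdf Z) (quantile Z u) = u.
Proof.
set F := fine \o cdf Z => FP /andP[u0 u1]; have [F1 Fr Fy dF] := FP.
have [M [M1 uM]] : exists M, 1 < M /\ u < F M.
  near (pinfty_nbhs R) => M; exists M; split; near: M.
    by apply: nbhs_pinfty_gt; exact: num_real.
  exact: (cvgr_gt _ Fy).
have cF : {within `[1, M], continuous F}.
  apply: derivable_oo_LRcontinuous_within; split.
  - by move=> x; rewrite in_itv/= => /andP[x1 _]; have [] := dF x x1.
  - by rewrite F1.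
  - apply: cvg_at_left_filter; apply: differentiable_continuous.
    by apply/derivable1_diffP; have [] := dF M M1.
have [|x xM Fx] := @IVT R F 1 M u (ltW M1) cF.
  by rewrite F1 ge_min le_max (ltW u0) (ltW uM) orbT.
have x1 : 1 < x.
  move: xM; rewrite in_itv/= le_eqVlt => /andP[/predU1P[x1|//] _].
  by move: u0; rewrite -Fx -x1 F1 ltxx.
suff -> : quantile Z u = x by [].
(* [F] is strictly increasing from [1] on, and to the left of [1] it is at most [F 1 < F x]; so the
   preimage [x] of [u] is the least point of the set. *)
rewrite /quantile (_ : mkset _ = `[x, +oo[%classic); last first.
  have uE y : (u%:E <= cdf Z y)%E = (u <= F y).
    by rewrite /F/= -lee_fin fineK// fin_num_measure.
  apply/seteqP; split=> y; rewrite /= in_itv/= andbT uE -Fx.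
    rewrite leNgt => Fyx; rewrite leNgt; apply: contra Fyx => yx.
    have [y1|y1] := leP 1 y; first exact: (beta_prime_cdf_lt _ _ FP).
    apply: le_lt_trans (beta_prime_cdf_lt _ _ FP (lexx 1) x1).
    by rewrite /F/= fine_le ?fin_num_measure// cdf_nondecreasing// ltW.
  by move=> xy; rewrite /F/= fine_le ?fin_num_measure// cdf_nondecreasing.
by rewrite inf_itv.
Unshelve. all: by end_near. Qed.

Theorem theorem3 (R : realType) (alpha1 alpha2 lambda : R)
    (d1 d2 : measure_display)
    (T1 : measurableType d1) (T2 : measurableType d2)
    (P1 : probability T1 R) (P2 : probability T2 R)
    (X1 : 'I_2 -> {RV P1 >-> R}) (X2 : 'I_2 -> {RV P2 >-> R}) :
  0 < alpha1 -> alpha1 < alpha2 -> 0 < lambda ->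
  random_sample (gamma_pdf alpha1 lambda) X1 ->
  random_sample (gamma_pdf alpha2 lambda) X2 ->
  disp_le (moment_estimator X1) (moment_estimator X2).
Proof.
move=> a1_gt0 a12 _ /beta_prime_cdf_moment_estimator[k1 F1P].
move=> /beta_prime_cdf_moment_estimator[k2 F2P] u v u0 uv v1.
have [x1 e1] := quantile_beta_prime _ _ _ _ _ _ _ u F1P ltac:(lra).
have [y1 f1] := quantile_beta_prime _ _ _ _ _ _ _ v F1P ltac:(lra).
have [x2 e2] := quantile_beta_prime _ _ _ _ _ _ _ u F2P ltac:(lra).
have [y2 f2] := quantile_beta_prime _ _ _ _ _ _ _ v F2P ltac:(lra).
apply: (beta_prime_cdf_disp _ _ _ _ _ _ a1_gt0 a12 F1P F2P) => //.
- rewrite ltNge le_eqVlt; apply/negP => /predU1P[e|h].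
    by move: f2; rewrite e e2 => /eqP; rewrite lt_eqF.
  by have := beta_prime_cdf_lt _ _ F2P (ltW y2) h; rewrite e2 f2; lra.
- by rewrite e1 e2.
- by rewrite f1 f2.
Qed.
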